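(* Let $\Bbbk$ be a field and let $a,b,d$ be positive integers. The two-dimensional Veronese ring $V_{(a,b),d}$ is a convex semigroup ring.
   Context: $V_{(a,b),d}=\bigoplus_{i\ge0}R_{di}$, where $R=\Bbbk[x,y]$ is graded by $\deg x=a$, $\deg y=b$; equivalently, it is the $\Bbbk$-span of the monomials $x^{u}y^{v}$ with $d\mid au+bv$. A sequence $\{c_i=(a_i,b_i)\}_{i=1}^s$ in $\mathbb N^2$ with $a_1\le\cdots\le a_s$ is convex if $2c_i\le c_{i-1}+c_{i+1}$ componentwise for each $2\le i\le s-1$. A convex semigroup ring is a $\Bbbk$-subalgebra of $\Bbbk[x,y]$ generated by the monomials $x^{a_i}y^{b_i}$ for a convex sequence $\{(a_i,b_i)\}_{i=1}^s\subset\mathbb N^2$. *)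

(* Defs.v *)
From HB Require Import structures.
From mathcomp Require Import all_boot all_order all_algebra.
From mathcomp.multinomials Require Export mpoly.

Set Implicit Arguments.
Unset Strict Implicit.
Unset Printing Implicit Defensive.

Import GRing.Theory.

Local Open Scope ring_scope.

(* k[x, y] is {mpoly K[2]}: variable 0 is x and variable 1 is y. *)
Definition xdeg (m : 'X_{1..2}) : nat := m ord0.
Definition ydeg (m : 'X_{1..2}) : nat := m ord_max.

Definition weight (a b : nat) (m : 'X_{1..2}) : nat :=
  (a * xdeg m + b * ydeg m)%N.

Fact weight0 a b : weight a b 0%MM = 0%N.
Proof. by rewrite /weight /xdeg /ydeg !mnm0E !muln0. Qed.

Fact weightD a b :
  {morph weight a b : m1 m2 / (m1 + m2)%MM >-> (m1 + m2)%N}.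
Proof.
by move=> m1 m2; rewrite /weight /xdeg /ydeg !mnmDE !mulnDr addnACA.
Qed.

HB.instance Definition _ (a b : nat) :=
  isMeasure.Build 2 (weight a b) (weight0 a b) (weightD a b).

(* The sum of the graded pieces of degree d * i, where deg x = a, deg y = b;
   it is direct because pieces of distinct degrees are independent. *)
Definition veronese (K : fieldType) (a b d : nat) (p : {mpoly K[2]}) : Prop :=
  exists (n : nat) (f : nat -> {mpoly K[2]}),
    (forall i, f i \is (d * i)%N.-homog for (weight a b)) /\
    p = \sum_(i < n) f i.

Definition convex_sequence (c : seq (nat * nat)) : Prop :=
  sorted leq [seq x.1 | x <- c] /\
  forall i : nat, (0 < i)%N -> (i.+1 < size c)%N ->
    let ci j := nth (0%N, 0%N) c j in
    (2 * (ci i).1 <= (ci i.-1).1 + (ci i.+1).1)%N /\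
    (2 * (ci i).2 <= (ci i.-1).2 + (ci i.+1).2)%N.

(* The constructors are the closure conditions of GRing.subalg_closed. *)
Inductive generated_subalgebra (K : fieldType) (A : algType K) (X : seq A) :
    A -> Prop :=
| gen_mem x : x \in X -> generated_subalgebra X x
| gen_one : generated_subalgebra X 1
| gen_lin (k : K) u v :
    generated_subalgebra X u -> generated_subalgebra X v ->
    generated_subalgebra X (k *: u + v)
| gen_mul u v :
    generated_subalgebra X u -> generated_subalgebra X v ->
    generated_subalgebra X (u * v).

Definition monomial_xy (K : fieldType) (c : nat * nat) : {mpoly K[2]} :=
  'X_[[multinom [tuple c.1; c.2]]].

Definition convex_semigroup_ring (K : fieldType) (S : {mpoly K[2]} -> Prop) :
    Prop :=
  exists c : seq (nat * nat), convex_sequence c /\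
    forall p : {mpoly K[2]},
      S p <-> generated_subalgebra [seq monomial_xy K x | x <- c] p.

(* Main.v *)
Require Import Defs.
From mathcomp Require Import all_boot all_order all_algebra.
From mathcomp Require Import zify ring.

(** Put [L = {(u, v) in Z^2 : d %| a u + b v}].  The monomials of the Veronese
    ring are the points of [L] in the first quadrant.  Let [(0, e)] be the first
    point of [L] on the second axis and [(u, v)] the point with the least
    positive first coordinate and then the least second coordinate; these form
    a basis of [L].  From a basis [p, q] with second coordinates decreasing,
    the Hirzebruch-Jung step [q' = k q - p], where [k] is the ceiling of
    [p.2 / q.2], gives a new basis [q, q'].  Since [k >= 2], one has
    [2 q <= k q = p + q'], so the resulting sequence is convex.  It stops on the
    first axis, and the cones spanned by consecutive terms cover the quadrant,
    so each point of [L] in the quadrant is a combination with coefficients in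
    [nat] of two consecutive terms. *)

Set Implicit Arguments.
Unset Strict Implicit.
Unset Printing Implicit Defensive.

Import GRing.Theory.

(** * Convex sequences and the Hirzebruch-Jung chain *)

Lemma convex_sequence_cons p q r s :
    p.1 <= q.1 -> 2 * q.1 <= p.1 + r.1 -> 2 * q.2 <= p.2 + r.2 ->
    convex_sequence (q :: r :: s) ->
  convex_sequence (p :: q :: r :: s).
Proof.
move=> le_pq cvx1 cvx2 [srt cvx]; split; first by rewrite /= le_pq.
by case=> [|[|i]] // _ lt_i; apply: (cvx i.+1).
Qed.

Lemma convex_sequence2 p q : p.1 <= q.1 -> convex_sequence [:: p; q].
Proof. by move=> le_pq; split; [rewrite /= le_pq | case=> [|[]]]. Qed.

Definition two_term_combination (c : seq (nat * nat)) (x : nat * nat) : Prop :=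
  exists y z k l, [/\ y \in c, z \in c, x.1 = k * y.1 + l * z.1
                    & x.2 = k * y.2 + l * z.2].

Lemma two_term_combination_cons p c x :
  two_term_combination c x -> two_term_combination (p :: c) x.
Proof.
move=> [y [z [k [l [yc zc x1 x2]]]]]; exists y, z, k, l.
by split; rewrite // inE ?yc ?zc orbT.
Qed.

(* Elimination of [p] between [x = m q - n p] and [r = k q - p]. *)
Lemma elim_basis_vector_le k m n p q r x :
  x + n * p = m * q -> r + p = k * q -> n * k <= m ->
  x = (m - n * k) * q + n * r.
Proof.
move=> xE rE le_nk; apply: (@addIn (n * p)).
by rewrite xE -addnA -mulnDr rE mulnA -mulnDl subnK.
Qed.

Lemma elim_basis_vector_ge k m n p q r x :
  x + n * p = m * q -> r + p = k * q -> m <= n * k ->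
  x + (n * k - m) * q = n * r.
Proof.
move=> xE rE le_mn; apply: (@addIn (m * q)).
by rewrite -addnA -mulnDl subnK // -mulnA -rE mulnDr addnCA xE.
Qed.

(* The last clause covers the points [x = m q - n p], which lie beyond [q]
   as seen from [p]. *)
Lemma hirzebruch_jung_chain (a b d : nat) (p q : nat * nat) :
    p.1 <= q.1 -> q.2 < p.2 ->
    d %| a * p.1 + b * p.2 -> d %| a * q.1 + b * q.2 ->
  exists s, [/\ convex_sequence (p :: q :: s),
    all (fun x => d %| a * x.1 + b * x.2) (p :: q :: s) &
    forall x m n, x.1 + n * p.1 = m * q.1 -> x.2 + n * p.2 = m * q.2 ->
      two_term_combination (q :: s) x].
Proof.
have [N] := ubnP q.2; elim: N p q => // N IHN p q /ltnSE le_qN le_pq lt_qp dp dq.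
have [q0|q_gt0] := posnP q.2.
  exists [::]; split; first exact: convex_sequence2.
    by rewrite /= dp dq.
  (* On the first axis, [x.2 + n * p.2 = 0] with [p.2] positive forces [n = 0], so [x] is [m] times
     [q]. *)
  move=> x m n x1; rewrite q0 muln0 => /eqP.
  rewrite addn_eq0 muln_eq0 (gtn_eqF (leq_ltn_trans _ lt_qp)) // orbF.
  move=> /andP[/eqP x2 /eqP n0]; rewrite n0 addn0 in x1.
  by exists q, q, m, 0; rewrite inE eqxx q0 muln0 !addn0.
(* Adding [q.2 - 1] before dividing rounds up: [k] is the least integer with [p.2 <= k * q.2],
   whence [r.2 < q.2] below. *)
set k := (p.2 + q.2.-1) %/ q.2.
have Ek := divn_eq (p.2 + q.2.-1) q.2; rewrite -/k in Ek.
have lt_r := ltn_pmod (p.2 + q.2.-1) q_gt0.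
have k_ge2 : 2 <= k by rewrite /k leq_divRL //; lia.
have le1 : p.1 <= k * q.1 by nia.
have le2 : p.2 <= k * q.2 by nia.
pose r := (k * q.1 - p.1, k * q.2 - p.2).
have r1 : r.1 + p.1 = k * q.1 by rewrite subnK.
have r2 : r.2 + p.2 = k * q.2 by rewrite subnK.
have lt_rq : r.2 < q.2 by lia.
have dr : d %| a * r.1 + b * r.2.
  rewrite -(dvdn_addl _ dp).
  have -> : a * r.1 + b * r.2 + (a * p.1 + b * p.2) = k * (a * q.1 + b * q.2).
    by rewrite addnACA -!mulnDr r1 r2; lia.
  exact: dvdn_mull.
have [||s [cvx dvd gen]] := IHN q r _ _ lt_rq dq dr.
- exact: leq_trans le_qN.
- by nia.
exists (r :: s); split.
- by apply: convex_sequence_cons => //;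
    rewrite addnC (r1, r2) leq_mul2r k_ge2 orbT.
- by move: dvd; rewrite /= dp.
(* Substituting $p = kq - r$ in $x = mq - np$ gives $x = (m - nk)q + nr$. If $nk \le m$, this is in
   the cone of [q] and [r]; otherwise [x] lies beyond [r], where the induction hypothesis
   applies. *)
move=> x m n x1 x2; have [le_nk|lt_kn] := leqP (n * k) m.
  exists q, r, (m - n * k), n; rewrite !inE !eqxx orbT; split=> //.
    exact: elim_basis_vector_le x1 r1 le_nk.
  exact: elim_basis_vector_le x2 r2 le_nk.
apply: two_term_combination_cons; apply: (gen x n (n * k - m)).
  exact: elim_basis_vector_ge x1 r1 (ltnW lt_kn).
exact: elim_basis_vector_ge x2 r2 (ltnW lt_kn).
Qed.

(** * Lattice points of the quadrant *)

Lemma quadrant_lattice_convex_generators (a b d : nat) :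
    0 < a -> 0 < b -> 0 < d ->
  exists c : seq (nat * nat), [/\ convex_sequence c,
    all (fun x => d %| a * x.1 + b * x.2) c &
    forall x, d %| a * x.1 + b * x.2 -> two_term_combination c x].
Proof.
move=> a_gt0 b_gt0 d_gt0; pose e := d %/ gcdn b d.
have g_gt0 : 0 < gcdn b d by rewrite gcdn_gt0 b_gt0.
have dvd_e t : (d %| b * t) = (e %| t).
  rewrite -{1}(divnK (dvdn_gcdr b d)) -/e.
  rewrite -{2}(divnK (dvdn_gcdl b d)) mulnAC dvdn_pmul2r // Gauss_dvdr //.
  by rewrite /e /coprime -(eqn_pmul2r g_gt0) mul1n muln_gcdl !divnK
             ?dvdn_gcdl ?dvdn_gcdr // gcdnC.
(* Only the residue of the second coordinate modulo [d] matters; bounding [w] by [d] makes the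
   condition decidable, as minimization requires. *)
have ex_u : exists u, (0 < u) && [exists w : 'I_d, d %| a * u + b * w].
  exists d; rewrite d_gt0; apply/existsP; exists (Ordinal d_gt0).
  by rewrite muln0 addn0 dvdn_mull.
have [u /andP[u_gt0 /existsP[w dw]] u_min] := ex_minnP ex_u.
have u_minL i j : 0 < i -> d %| a * i + b * j -> u <= i.
  move=> i_gt0 dij; apply: u_min; rewrite i_gt0; apply/existsP.
  exists (Ordinal (ltn_pmod j d_gt0)) => /=.
  by rewrite /dvdn -modnDmr modnMmr modnDmr.
have ex_v : exists v, d %| a * u + b * v by exists w.
have [v dv v_min] := ex_minnP ex_v.
have e_gt0 : 0 < e by rewrite divn_gt0 // dvdn_leq // dvdn_gcdr.
have de : d %| b * e by rewrite dvd_e.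
(* Otherwise [(u, v - e)] would be a lattice point contradicting the minimality of [v]. *)
have lt_ve : v < e.
  rewrite ltnNge; apply/negP => le_ev.
  have /v_min : d %| a * u + b * (v - e).
    rewrite -(dvdn_addl _ de) -addnA -mulnDr subnK //.
  by rewrite leqNgt -subn_gt0 subKn ?e_gt0.
have [//|//||//|s [cvx dvd gen]] := @hirzebruch_jung_chain a b d (0, e) (u, v).
  by rewrite /= muln0.
exists [:: (0, e), (u, v) & s]; split=> // -[x1 x2] /= dx.
pose k := x1 %/ u.
have Ex1 : x1 = k * u.
  rewrite [LHS](divn_eq x1 u) -/k; have [->|r_gt0] := posnP (x1 %% u).
    by rewrite addn0.
  (* A positive remainder contradicts the minimality of [u]: subtract [k] times [(u, v)] from the
     point, then add [k * v * d] to the second coordinate to keep it in [nat]. *)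
  have := ltn_pmod x1 u_gt0; rewrite ltnNge (@u_minL _ (x2 + k * v * d.-1)) //.
  rewrite -(dvdn_addl _ (dvdn_mull k dv)).
  have -> : a * (x1 %% u) + b * (x2 + k * v * d.-1) + k * (a * u + b * v)
            = a * x1 + b * x2 + b * k * v * d.
    rewrite [in RHS](divn_eq x1 u) -/k -{2}(prednK d_gt0); ring.
  by rewrite dvdn_addl // dvdn_mull.
have dkv := dvdn_mull k dv.
(* The difference of the point and [k] times [(u, v)] is a multiple of [(0, e)]. If it is
   nonnegative, the first two terms suffice; otherwise the last clause of the chain lemma
   applies. *)
have [le_kv|lt_kv] := leqP (k * v) x2.
  have /dvdnP[n En] : e %| x2 - k * v.
    rewrite -dvd_e -(dvdn_addl _ dkv).
    have -> // : b * (x2 - k * v) + k * (a * u + b * v) = a * x1 + b * x2.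
    by rewrite -[in RHS](subnK le_kv) Ex1; ring.
  exists (0, e), (u, v), n, k; rewrite !inE !eqxx orbT; split=> //=.
    by rewrite muln0.
  by rewrite -En subnK.
have /dvdnP[n En] : e %| k * v - x2.
  rewrite -dvd_e -(dvdn_addl _ dx).
  have -> : b * (k * v - x2) + (a * x1 + b * x2) = k * (a * u + b * v).
    rewrite Ex1 addnCA -mulnDr subnK ?(ltnW lt_kv) //; ring.
  exact: dkv.
apply: two_term_combination_cons; apply: (gen _ k n) => /=.
  by rewrite muln0 addn0.
by rewrite -En subnKC // ltnW.
Qed.

Local Open Scope ring_scope.

(** * From lattice points to polynomials *)

Lemma veroneseP (K : fieldType) (a b d : nat) (p : {mpoly K[2]}) :
    (0 < d)%N ->
  veronese a b d p <-> {in msupp p, forall m, d %| weight a b m}%N.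
Proof.
move=> d_gt0; split=> [[n [f [homf ->]]] m /msupp_sum_le|dvd_p].
  case/flattenP=> _ /mapP[i _ ->] m_fi.
  by rewrite (dhomog_mf (homf i) m_fi) dvdn_mulr.
(* The measure of [p] strictly exceeds the weights in its support, so it also bounds every [i] with
   [d * i] such a weight. Each monomial then lies in exactly one component. *)
exists (mmeasure (weight a b) p), (fun i => pihomog (weight a b) (d * i) p).
split=> [i|]; first exact: pihomogP.
rewrite (exchange_big_dep predT) //= {1}[p]mpolyE !big_seq.
apply: eq_bigr => m m_p; have /dvdnP[i Ei] := dvd_p m m_p.
have lt_i : (i < mmeasure (weight a b) p)%N.
  by apply: leq_ltn_trans (mmeasure_mnm_lt (weight a b) m_p);
    rewrite /= Ei leq_pmulr.
rewrite (big_pred1 (Ordinal lt_i)) // => j /=.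
by rewrite Ei mulnC eqn_pmul2l // eq_sym.
Qed.

Lemma monomial_xyD (K : fieldType) (x y : nat * nat) :
  monomial_xy K (x.1 + y.1, x.2 + y.2)%N = monomial_xy K x * monomial_xy K y.
Proof.
rewrite /monomial_xy -mpolyXD; congr 'X_[_]; apply/mnmP => i.
by rewrite mnmDE !multinomE; case: i => [[|[]]].
Qed.

Lemma monomial_xy0 (K : fieldType) : monomial_xy K (0, 0)%N = 1.
Proof.
rewrite -mpolyX0 /monomial_xy; congr 'X_[_]; apply/mnmP => i.
by rewrite mnm0E multinomE; case: i => [[|[]]].
Qed.

Lemma monomial_xyE (K : fieldType) (m : 'X_{1..2}) :
  monomial_xy K (xdeg m, ydeg m) = 'X_[m].
Proof.
congr 'X_[_]; apply/mnmP => i; rewrite multinomE /xdeg /ydeg.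
by case: i => [[|[]]] //= lt_i; congr (m _); apply: val_inj.
Qed.

Lemma generated_subalgebra_exp (K : fieldType) (A : algType K) (X : seq A) u n :
  generated_subalgebra X u -> generated_subalgebra X (u ^+ n).
Proof.
move=> Xu; elim: n => [|n IHn]; first exact: gen_one.
by rewrite exprS; apply: gen_mul.
Qed.

Lemma generated_subalgebra0 (K : fieldType) (A : algType K) (X : seq A) :
  generated_subalgebra X 0.
Proof.
have := gen_lin (-1) (gen_one X) (gen_one X).
by rewrite scaleN1r addNr.
Qed.

Lemma monomial_xyM (K : fieldType) (x : nat * nat) n :
  monomial_xy K (n * x.1, n * x.2)%N = monomial_xy K x ^+ n.
Proof.
elim: n => [|n IHn]; first exact: monomial_xy0.
by rewrite exprS -IHn -monomial_xyD.
Qed.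

Lemma generated_monomial (K : fieldType) c x :
    two_term_combination c x ->
  generated_subalgebra [seq monomial_xy K y | y <- c] (monomial_xy K x).
Proof.
move=> [y [z [k [l [yc zc x1 x2]]]]]; rewrite [x]surjective_pairing x1 x2.
have := @monomial_xyD K (k * y.1, k * y.2)%N (l * z.1, l * z.2)%N => /= ->.
rewrite !monomial_xyM; apply: gen_mul; apply: generated_subalgebra_exp.
  exact/gen_mem/map_f.
exact/gen_mem/map_f.
Qed.

Theorem proposition3p2 (K : fieldType) (a b d : nat)
    (ha : (0 < a)%N) (hb : (0 < b)%N) (hd : (0 < d)%N) :
  convex_semigroup_ring (@veronese K a b d).
Proof.
have [c [cvx dvd_c gen_c]] := quadrant_lattice_convex_generators ha hb hd.
exists c; split=> // p; split=> [/(veroneseP _ _ _ hd) dvd_p|].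
  rewrite [p]mpolyE big_seq.
  elim/big_rec: _ => [|m q m_p Xq]; first exact: generated_subalgebra0.
  apply: gen_lin => //; rewrite -monomial_xyE; apply: generated_monomial.
  exact/gen_c/dvd_p.
move=> Xp; apply/veroneseP => //.
(* Divisibility by [d] of all weights in the support survives each closure rule; for products this
   is additivity of the weight. *)
elim: Xp => {p} [_ /mapP[x xc ->]||k u v _ IHu _ IHv|u v _ IHu _ IHv] m.
- move/mem_msuppXP <-; exact: (allP dvd_c).
- by rewrite msupp1 inE => /eqP->; rewrite weight0.
- by move=> /msuppD_le; rewrite mem_cat => /orP[/msuppZ_le/IHu|/IHv].
- by case/msuppM_le/allpairsP => -[m1 m2] /= [/IHu d1 /IHv d2 ->];
    rewrite weightD dvdn_add.
Qed.
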